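(* Let $G=\langle A,\beta\mid \beta^2=\alpha,\ \beta a\beta^{-1}=f(a)\ \text{for all } a\in A\rangle$ be a finite non-abelian group of order $2n$ ($n>1$), where $A$ is an abelian subgroup of index $2$, $\alpha\in A$, and $f$ is an automorphism of $A$ of order $2$ with $f(\alpha)=\alpha$. Let $X\subseteq A\setminus\{e\}$ with $X\cap f(X)=\emptyset$, let $Y\in\{A\setminus X,\ A\setminus f(X)\}$, and let $B=A\setminus(X\cup f(X))$. Then the Cayley graph $\Gamma=\mathrm{Cay}(G,X\cup Y\beta)$ is a DSRG if and only if $B$ is a subgroup of $A$ and $X$ is a union of cosets of $B$ in $A$. In this case $\Gamma$ has parameters $(2n,n,\frac{n+\ell}{2},\frac{n-\ell}{2},\frac{n+\ell}{2})$, where $\ell=|B|$.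
   Context: $e$ denotes the identity. For a finite group $H$ and $S\subseteq H\setminus\{e\}$, $\mathrm{Cay}(H,S)$ is the directed graph with vertex set $H$ and an arc from $x$ to $y$ iff $yx^{-1}\in S$. $Y\beta=\{y\beta:y\in Y\}$, $f(X)=\{f(x):x\in X\}$. A DSRG with parameters $(N,k,\mu,\lambda,t)$ is a $k$-regular loopless directed graph on $N$ vertices such that every vertex $x$ has exactly $t$ vertices $z$ with $x\to z$ and $z\to x$, and for vertices $x\ne y$ the number of $z$ with $x\to z\to y$ is $\lambda$ if $x\to y$ and $\mu$ otherwise; throughout it is assumed that $0<t<k$.
   Formalization: ''Union of cosets'' is read as a union of at least one coset: for X empty, B = A is a subgroup but Γ is complete bipartite with t = k = n, so it is not a DSRG under 0 < t < k and the equivalence would fail. *)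

(* Defs.v *)
From mathcomp Require Import all_boot all_fingroup.

Set Implicit Arguments.
Unset Strict Implicit.
Unset Printing Implicit Defensive.

Local Open Scope group_scope.

Definition cayley_rel (gT : finGroupType) (S : {set gT}) : rel gT :=
  fun x y => y * x^-1 \in S.

(* The parameters are listed in the order (N, k, mu, lambda, t). The bound     *)
(* t < k excludes symmetric (undirected) graphs.                              *)
Definition is_dsrg (T : finType) (e : rel T) (N k mu lam t : nat) : Prop :=
  [/\ #|T| = N,
      (0 < t < k)%N,
      irreflexive e,
      forall x : T, #|[set z | e x z]| = k /\ #|[set z | e z x]| = k
    & (forall x : T, #|[set z | e x z && e z x]| = t) /\
      (forall x y : T, x != y ->
         #|[set z | e x z && e z y]| = if e x y then lam else mu)].

Definition dsrg (T : finType) (e : rel T) : Prop :=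
  exists N k mu lam t : nat, is_dsrg e N k mu lam t.

(* Only unions of a nonempty family of cosets are meant. If the empty union   *)
(* X = set0 were allowed, it would give B = A and the complete bipartite graph *)
(* Cay(G, A beta), which has t = k and so is not a DSRG.                      *)
Definition union_of_cosets (gT : finGroupType) (A B X : {set gT}) : Prop :=
  exists P : {set {set gT}},
    [/\ P != set0, P \subset rcosets B A & X = cover P].

(* Main.v *)
Require Import Defs.
From mathcomp Require Import all_boot all_fingroup.
From mathcomp Require Import zify.

(* Write S = X u Y beta and X' = f(X). Counting products on the coset A beta,  *)
(* Gamma has constant lambda and mu there iff the number of ways to write      *)
(* h = bx with b in B and x in X is constant on X and constant off X. As B is  *)
(* the complement of X u X', the number r(h) of ways to write h = bb' is then  *)
(* constant on B and constant off B. Let s(h) be the number of ways to write   *)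
(* h = b b'^-1. Since A is abelian, sum r^2 = sum s^2, and since r takes one   *)
(* value on B and one off B, also sum rs = sum r^2. Hence r = s, so            *)
(* r(1) = s(1) = |B|, and r = |B| on all of B, which makes B a subgroup.       *)
(* Conversely alpha, being fixed by f, cannot lie in X or X', so it lies in B  *)
(* and drops out of the count of S^2 on A.                                     *)

(** All counting takes place inside the abelian group [A], with [nsol U V] as the convolution of two
    indicator functions. Since [X], [f @: X] and [B] partition [A], the convolution square of [S]
    reduces to [nsol B Z] on [A :* beta] ([nsol_coset_count]) and to convolutions of [X] with [X]
    and [f @: X] on [A] ([nsol_group_count]). If the graph is a DSRG, the coset count and its image
    under [f] ([dsrg_nsol_base]) make [nsol B B] constant on [B] and on the rest of [A].
    [nsol_two_valued_group] then makes [B] a subgroup; its value of [nsol B B] on [B] forces lambda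
    = |X|, which leaves no room for a product [x * b] outside [X] ([dsrg_base]). Conversely, when
    [X] is a union of [B]-cosets, every count is decided by membership in [X] or [Z]
    ([base_dsrg]). *)

Set Implicit Arguments.
Unset Strict Implicit.
Unset Printing Implicit Defensive.

Local Open Scope group_scope.

(** * Convolution counts, and a criterion for a subset of an abelian group to be a subgroup *)

Section Convolution.

Context {gT : finGroupType}.
Implicit Types (A : {group gT}) (U V W S B : {set gT}) (g h : gT).

(* The number of pairs (u, v) in U x V with u * v = g. *)
Definition nsol U V g : nat := \sum_(v in V) (g * v^-1 \in U)%g.

Lemma sum_mem_card (T : finType) (P Q : {pred T}) :
  \sum_(x in P) (x \in Q : nat) = #|[predI P & Q]|.
Proof. by rewrite -sum1_card big_mkcondr; apply: eq_bigr => x _; case: (x \in Q). Qed.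

Lemma nsolT A U g : U \subset A -> g \in A -> nsol U A g = #|U|.
Proof.
move=> sUA Ag; rewrite /nsol (reindex_inj invg_inj) /=.
rewrite (reindex_inj (mulgI g^-1)) /=.
under eq_bigl => v do rewrite groupV groupMl ?groupV //.
under eq_bigr => v _ do rewrite invgK mulKVg.
by rewrite sum_mem_card; apply: eq_card => v; rewrite !inE andb_idl // => /(subsetP sUA).
Qed.

Lemma nsolC A U V g :
  abelian A -> U \subset A -> V \subset A -> g \in A -> nsol U V g = nsol V U g.
Proof.
move=> cAA sUA sVA Ag; rewrite /nsol big_mkcond /= [RHS]big_mkcond /=.
rewrite [RHS](reindex_inj invg_inj) (reindex_inj (mulIg g)) /=.
apply: eq_bigr => v _; rewrite invgK invMg mulKVg.
have [Av|] := boolP (v \in A).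
  by rewrite (centsP cAA v Av g Ag); do 2 case: (_ \in _).
move=> nAv; rewrite !ifN //; apply: contra nAv.
  by move=> /(subsetP sUA); rewrite groupV.
by move=> /(subsetP sVA); rewrite groupMr.
Qed.

Lemma nsolUr U V W g :
  [disjoint V & W] -> nsol U (V :|: W) g = (nsol U V g + nsol U W g)%N.
Proof. by move=> dVW; rewrite /nsol -bigU //; apply: eq_bigl => v; rewrite !inE. Qed.

Lemma nsolDr U V W g :
  W \subset V -> (nsol U W g + nsol U (V :\: W) g)%N = nsol U V g.
Proof.
move=> sWV; rewrite -[in RHS](setID V W) (setIidPr sWV) nsolUr //.
by rewrite disjoints_subset setCD subsetUr.
Qed.

(** The morphism hypothesis concerns [a * b^-1] because that is the only expression [nsol] tests. *)
Lemma nsol_im A (phi : gT -> gT) U V g :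
  {in A &, injective phi} -> {in A, forall a, phi a \in A} ->
  {in A &, {morph phi : a b / a * b^-1}} ->
  U \subset A -> V \subset A -> g \in A ->
  nsol (phi @: U) (phi @: V) (phi g) = nsol U V g.
Proof.
move=> injphi phiA phiM /subsetP sUA /subsetP sVA Ag.
rewrite /nsol big_imset /=; last by move=> x y /sVA Ax /sVA; apply: injphi.
apply: eq_bigr => v /sVA Av; congr nat_of_bool.
rewrite -phiM //; apply/imsetP/idP => [[u Uu]|Uv]; last by eexists; eauto.
by move/injphi=> ->; rewrite ?groupM ?groupV // ?sUA.
Qed.

Lemma nsolV U V g : nsol U V^-1 g = \sum_(v in V) (g * v \in U)%g.
Proof.
rewrite /nsol (reindex_inj invg_inj) /=.
by apply: eq_big => [v|v _]; rewrite ?inE invgK.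
Qed.

Lemma nsol_card U V g : nsol U V g = #|V| -> {in V, forall v, g * v^-1 \in U}.
Proof.
rewrite /nsol (sum_mem_card (mem V) [pred v | g * v^-1 \in U]).
move=> /subset_cardP hV v Vv; move: hV => /(_ _)/(_ v); rewrite !inE Vv /= => -> //.
by apply/subsetP => x /andP[].
Qed.

Lemma nsol_eq0 U V g : nsol U V g = 0%N -> {in V, forall v, g * v^-1 \notin U}.
Proof. by move/eqP; rewrite sum_nat_eq0 => /forall_inP h v /h; rewrite eqb0. Qed.

Lemma nsol_stable U V g : {in V, forall v, (g * v^-1 \in U) = (g \in U)} ->
  nsol U V g = if g \in U then #|V| else 0%N.
Proof.
move=> hU; rewrite /nsol (eq_bigr (fun=> (g \in U) : nat)) => [|v Vv].
  by rewrite sum_nat_const; case: (g \in U); rewrite ?muln1 ?muln0.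
by rewrite hU.
Qed.

Lemma sum_nsol U V (F : gT -> nat) :
  \sum_g nsol U V g * F g = \sum_(u in U) \sum_(v in V) F (u * v)%g.
Proof.
rewrite exchange_big /= /nsol.
under eq_bigr => g _ do rewrite big_distrl /=.
rewrite exchange_big; apply: eq_bigr => v _.
rewrite (reindex_inj (mulIg v)) [RHS]big_mkcond /=; apply: eq_bigr => u _.
by rewrite mulgK; case: (u \in U); rewrite ?mul1n ?mul0n.
Qed.

(* The additive energy of B can be computed from products as well as from     *)
(* quotients: ab = cd iff a c^-1 = d b^-1.                                    *)
Lemma energy_nsol A B : abelian A -> B \subset A ->
  \sum_g nsol B B g * nsol B B g = \sum_g nsol B B^-1 g * nsol B B^-1 g.
Proof.
move=> cAA /subsetP sBA; rewrite !sum_nsol; apply: eq_bigr => a Ba.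
rewrite [RHS](reindex_inj invg_inj) /=.
under [RHS]eq_bigl => b do rewrite inE invgK.
under [RHS]eq_bigr => b Bb do rewrite nsolV.
rewrite [RHS]exchange_big /=; apply: eq_bigr => b Bb; apply: eq_bigr => d Bd.
by rewrite -!mulgA (centsP cAA b (sBA _ Bb)) ?groupV ?sBA.
Qed.

(* Equality in sum 2rs <= sum (r^2 + s^2). *)
Lemma nsol_two_valued_inv A B P Q : abelian A -> B \subset A ->
  {in A, forall g, nsol B B g = if g \in B then P else Q} ->
  nsol B B =1 nsol B B^-1.
Proof.
move=> cAA sBA hB; have BA := subsetP sBA.
(* For fixed b in [B], the map a -> a * b is a bijection from the a in [B] with a * b in [B] to the
   a in [B] with a * b^-1 in [B]. As [nsol B B] only sees membership in [B], its sums over the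
   products a * b and over the quotients a * b^-1 agree. *)
have hmix : \sum_g nsol B B^-1 g * nsol B B g = \sum_g nsol B B g * nsol B B g.
  rewrite !sum_nsol exchange_big /= (reindex_inj invg_inj) /= [RHS]exchange_big /=.
  under eq_bigl => b do rewrite inE invgK.
  apply: eq_bigr => b Bb.
  pose k := #|[predI B & [pred x | x * b \in B]]|.
  have card_if (R : {pred gT}) : #|[predI B & R]| = k ->
      \sum_(a in B) (if a \in R then P else Q) = (k * P + (#|B| - k) * Q)%N.
    move=> hk; rewrite (bigID (mem R)) /=; congr (_ + _)%N.
      rewrite (eq_bigr (fun=> P)) => [|i /andP[_ ->] //].
      by rewrite sum_nat_const -hk; congr (_ * _)%N; apply: eq_card.
    rewrite (eq_bigr (fun=> Q)) => [|i /andP[_ /negPf-> //]].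
    rewrite sum_nat_const; congr (_ * _)%N; rewrite -hk -(cardID R B) addKn.
    by apply: eq_card => x; rewrite !inE andbC.
  transitivity (k * P + (#|B| - k) * Q)%N.
    rewrite -(card_if [pred x | x * b^-1 \in B]); last first.
      rewrite /k -!sum1_card (reindex_inj (mulIg b)).
      by apply: eq_bigl => x /=; rewrite !inE mulgK andbC.
    by apply: eq_bigr => a Ba; rewrite hB ?groupM ?groupV ?BA.
  rewrite -(card_if [pred x | x * b \in B]) //.
  by apply: eq_bigr => a Ba; rewrite hB ?groupM ?BA.
have hle : forall g, true ->
   2 * (nsol B B^-1 g * nsol B B g) <= nsol B B^-1 g ^ 2 + nsol B B g ^ 2
     ?= iff (nsol B B^-1 g == nsol B B g) by move=> g _; apply: nat_Cauchy.
have /leqif_sum [_ ] := hle; rewrite -big_distrr big_split /= hmix.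
under [X in _ == (X + _)%N]eq_bigr => g _ do rewrite -mulnn.
under [X in _ == (_ + X)%N]eq_bigr => g _ do rewrite -mulnn.
rewrite -(energy_nsol cAA sBA) addnn mul2n eqxx => /esym/forallP heq g.
by apply/esym/eqP/(implyP (heq g)).
Qed.

(** At 1 the quotient count is |B|, so the product count is too, and [P] = |B|. Then for a in [B]
    the count [nsol B B a] is maximal, so every [a * b^-1] lies in [B]. *)
Lemma nsol_two_valued_group A B P Q : abelian A -> B \subset A -> 1 \in B ->
  {in A, forall g, nsol B B g = if g \in B then P else Q} ->
  group_set B /\ P = #|B|.
Proof.
move=> cAA sBA B1 hB; have BA := subsetP sBA.
have hP : P = #|B|.
  have := hB 1 (group1 A); rewrite B1 (nsol_two_valued_inv cAA sBA hB) => <-.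
  rewrite nsolV -sum1_card; apply: eq_bigr => b Bb; by rewrite mul1g Bb.
have divB : {in B &, forall a b, a * b^-1 \in B}.
  by move=> a b Ba Bb; apply: nsol_card Bb; rewrite hB ?BA // Ba.
have invB : {in B, forall b, b^-1 \in B}.
  by move=> b Bb; rewrite -[_^-1]mul1g divB.
split=> //; apply/group_setP; split=> // a b Ba Bb.
by rewrite -[b]invgK divB ?invB.
Qed.

(** * The DSRG conditions of a Cayley graph in terms of its connection set *)

Lemma card_cayley_paths S x y :
  #|[set z | cayley_rel S x z && cayley_rel S z y]| = nsol S S (y * x^-1).
Proof.
rewrite /nsol (sum_mem_card (mem S) [pred v | y * x^-1 * v^-1 \in S]).
rewrite -!sum1_card (reindex_inj (mulIg x)) /=; apply: eq_bigl => z.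
by rewrite !inE /cayley_rel mulgK invMg mulgA.
Qed.

(** Right translations are automorphisms of the Cayley graph, so every condition may be tested from
    the vertex 1. *)
Lemma is_dsrg_cayleyP S N k mu lam t :
  is_dsrg (cayley_rel S) N k mu lam t <->
  [/\ #|gT| = N, (0 < t < k)%N, 1 \notin S, #|S| = k
    & nsol S S 1 = t /\
      forall g, g != 1 -> nsol S S g = if g \in S then lam else mu].
Proof.
have out x : #|[set z | cayley_rel S x z]| = #|S|.
  rewrite -!sum1_card (reindex_inj (mulIg x)) /=; apply: eq_bigl => z.
  by rewrite !inE /cayley_rel mulgK.
have inn x : #|[set z | cayley_rel S z x]| = #|S|.
  rewrite -!sum1_card (reindex_inj invg_inj) (reindex_inj (mulgI x^-1)) /=.
  by apply: eq_bigl => z; rewrite !inE /cayley_rel invgK mulKVg.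
split=> [[hN ht irr hk [h1 h2]]|[hN ht S1 hk [h1 h2]]].
  split=> //; first by have := irr 1; rewrite /cayley_rel mulgV => ->.
    by have [<- _] := hk 1; rewrite out.
  split=> [|g ng1]; first by rewrite -(h1 1) card_cayley_paths mulgV.
  by have := h2 1 g; rewrite eq_sym card_cayley_paths /cayley_rel !invg1 !mulg1; apply.
split=> // [x|x|]; first by rewrite /cayley_rel mulgV; apply: negPf.
  by rewrite out inn.
split=> [x|x y nxy]; first by rewrite card_cayley_paths mulgV.
rewrite card_cayley_paths h2 //; apply: contra nxy => /eqP.
by move/(canRL (mulgKV _)); rewrite mul1g => ->.
Qed.

End Convolution.

(** * An abelian subgroup with two cosets [A] and [A :* beta], and the conjugation twist [f] *)

Section IndexTwo.

Variables (gT : finGroupType) (A : {group gT}) (beta : gT) (f : gT -> gT).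
Implicit Types U V : {set gT}.
Hypothesis cAA : abelian A.
Hypothesis fA : {in A, forall a, f a \in A}.
Hypothesis fE : {in A, forall a, f a = beta * a * beta^-1}.
Hypothesis nAbeta : beta \notin A.
Hypothesis Abeta2 : beta ^+ 2 \in A.
Hypothesis covA : A :|: A :* beta = [set: gT].

Lemma twist_divr : {in A &, {morph f : a b / a * b^-1}}.
Proof.
by move=> a b Aa Ab; rewrite !fE ?groupM ?groupV // !invMg invgK !mulgA mulgKV.
Qed.

(** Applying [f] twice is conjugation by [beta ^+ 2], which lies in the abelian group [A]. *)
Lemma twistK : {in A, cancel f f}.
Proof.
move=> a Aa; have -> : f (f a) = beta ^+ 2 * a * beta ^- 2.
  by rewrite fE ?fA // fE // expg2 invMg !mulgA.
by rewrite (centsP cAA _ Abeta2 _ Aa) mulgK.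
Qed.

Lemma twist_inj : {in A &, injective f}.
Proof. exact: can_in_inj twistK. Qed.

Lemma mem_twist U a : U \subset A -> a \in A -> (a \in f @: U) = (f a \in U).
Proof.
move=> /subsetP sUA Aa; apply/imsetP/idP => [[u Uu ->]|Uf]; first by rewrite twistK ?sUA.
by exists (f a); rewrite ?twistK.
Qed.

Lemma twist_sub U : U \subset A -> f @: U \subset A.
Proof. by move=> /subsetP sUA; apply/subsetP=> _ /imsetP[u /sUA Au ->]; apply: fA. Qed.

Lemma twist_setK U : U \subset A -> f @: (f @: U) = U.
Proof.
move=> sUA; apply/setP=> a; have [Aa|nAa] := boolP (a \in A).
  by rewrite !mem_twist ?twist_sub ?fA ?twistK.
by apply/idP/idP => [/(subsetP (twist_sub (twist_sub sUA)))|/(subsetP sUA)];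
  rewrite (negPf nAa).
Qed.

Lemma card_twist U : U \subset A -> #|f @: U| = #|U|.
Proof.
by move=> /subsetP sUA; apply: card_in_imset => x y /sUA Ax /sUA; apply: twist_inj.
Qed.

Lemma twist_setD U : U \subset A -> f @: (A :\: U) = A :\: f @: U.
Proof.
move=> sUA; apply/setP=> a; have [Aa|nAa] := boolP (a \in A).
  by rewrite mem_twist ?subsetDl // !inE mem_twist // Aa fA.
rewrite !inE (negPf nAa) andbF; apply/negbTE; apply: contra nAa.
exact/subsetP/twist_sub/subsetDl.
Qed.

Lemma coset_notin a : a \in A -> a * beta \notin A.
Proof. by move=> Aa; rewrite groupMl. Qed.

(** * The convolution square of [X :|: Y :* beta] on each coset of [A] *)

Section Connection.

Variables X Y : {set gT}.
Hypotheses (sXA : X \subset A) (sYA : Y \subset A).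
Let S : {set gT} := X :|: Y :* beta.

Lemma conn_group a : a \in A -> (a \in S) = (a \in X).
Proof.
move=> Aa; rewrite !inE mem_rcoset orb_idr // => /(subsetP sYA).
by rewrite groupMl // groupV (negPf nAbeta).
Qed.

Lemma conn_coset a : a \in A -> (a * beta \in S) = (a \in Y).
Proof.
move=> Aa; rewrite !inE mem_rcoset mulgK orb_idl // => /(subsetP sXA).
by rewrite (negPf (coset_notin Aa)).
Qed.

Lemma conn_disjoint : [disjoint X & Y :* beta].
Proof.
rewrite disjoints_subset; apply/subsetP => x /(subsetP sXA) Ax; rewrite inE.
by apply/rcosetP => -[y /(subsetP sYA) /coset_notin Ay eqx]; rewrite -eqx Ax in Ay.
Qed.

Lemma card_conn : #|S| = (#|X| + #|Y|)%N.
Proof.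
by have /leqifP := leq_card_setU X (Y :* beta); rewrite conn_disjoint card_rcoset => /eqP.
Qed.

Lemma nsol_rcoset U g : nsol U (Y :* beta) g = \sum_(w in Y) (g * (w * beta)^-1 \in U)%g.
Proof. by rewrite /nsol -rcosetE big_imset //= => x y _ _; apply: mulIg. Qed.

Lemma nsol_twist U V g : V \subset A ->
  nsol U (f @: V) g = \sum_(v in V) (g * (f v)^-1 \in U)%g.
Proof.
move=> /subsetP sVA; rewrite /nsol big_imset //= => x y /sVA Ax /sVA.
exact: twist_inj.
Qed.

(** A product in [A] has both factors in [X] or both in [Y :* beta], and (y beta)(w beta) = y f(w)
    beta^2. *)
Lemma nsol_conn_group g : g \in A ->
  nsol S S g = (nsol X X g + nsol Y (f @: Y) (g * beta ^- 2))%N.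
Proof.
move=> Ag; rewrite {2}/S nsolUr ?conn_disjoint //; congr addn.
  by apply: eq_bigr => x /(subsetP sXA) Ax; rewrite conn_group // groupM ?groupV.
rewrite nsol_rcoset nsol_twist //; apply: eq_bigr => w /(subsetP sYA) Aw.
have -> : g * (w * beta)^-1 = g * beta ^- 2 * (f w)^-1 * beta.
  by rewrite fE // expg2 !invMg invgK !mulgA !mulgKV.
by rewrite conn_coset // !groupM ?groupV ?fA.
Qed.

(** The two terms come from (y beta) x = y f(x) beta and x (y beta). *)
Lemma nsol_conn_coset h : h \in A ->
  nsol S S (h * beta) = (nsol Y (f @: X) h + nsol X Y h)%N.
Proof.
move=> Ah; rewrite {2}/S nsolUr ?conn_disjoint //; congr addn.
  rewrite nsol_twist //; apply: eq_bigr => x /(subsetP sXA) Ax.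
  have -> : h * beta * x^-1 = h * (f x)^-1 * beta.
    by rewrite fE // !invMg invgK !mulgA !mulgKV.
  by rewrite conn_coset // groupM ?groupV ?fA.
rewrite nsol_rcoset; apply: eq_bigr => w /(subsetP sYA) Aw.
by rewrite invMg !mulgA mulgK conn_group // groupM ?groupV.
Qed.

End Connection.

(** * The connection set with [Y] the complement of [Z], where [Z] covers both choices of [Y] *)

Variables X Z B : {set gT}.
Hypothesis sXA : X \subset A.
Hypothesis nX1 : 1 \notin X.
Hypothesis dXf : [disjoint X & f @: X].
Hypothesis defZ : Z = X \/ Z = f @: X.
Hypothesis defB : B = A :\: (X :|: f @: X).
Let Y : {set gT} := A :\: Z.
Let S : {set gT} := X :|: Y :* beta.

Let sfXA : f @: X \subset A := twist_sub sXA.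

Lemma base_sub : B \subset A. Proof. by rewrite defB subsetDl. Qed.
Lemma twin_sub : Z \subset A. Proof. by case: defZ => ->. Qed.
Let sYA : Y \subset A := subsetDl A Z.

Lemma card_twin : #|Z| = #|X|.
Proof. by case: defZ => ->; rewrite ?card_twist. Qed.

Lemma twist_base : f @: B = B.
Proof. by rewrite defB twist_setD ?subUset ?sXA // imsetU twist_setK // setUC. Qed.

Lemma base1 : 1 \in B.
Proof.
have f1 : f 1 = 1 by rewrite fE // mulg1 mulgV.
by rewrite defB !inE mem_twist // f1 (negPf nX1) group1.
Qed.

Lemma nsol_partition U g : U \subset A -> g \in A ->
  (nsol U X g + nsol U (f @: X) g + nsol U B g)%N = #|U|.
Proof.
move=> sUA Ag; rewrite -nsolUr // defB nsolDr ?subUset ?sXA //.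
exact: nsolT.
Qed.

Lemma card_partition_twist : #|A| = (2 * #|X| + #|B|)%N.
Proof.
have sU : X :|: f @: X \subset A by rewrite subUset sXA.
rewrite -(cardsID (X :|: f @: X) A) (setIidPr sU) -defB; congr addn.
have /leqifP := leq_card_setU X (f @: X); rewrite dXf => /eqP->.
by rewrite card_twist // mul2n addnn.
Qed.

Lemma card_coset_part : #|Y| = (#|X| + #|B|)%N.
Proof.
have := cardsID Z A; rewrite (setIidPr twin_sub) card_twin -/Y card_partition_twist.
by clear; lia.
Qed.

(** The factors [X] and [f @: X] together amount to |Y| minus the convolution of [Y] with [B], and
    replacing [Y] by [Z] turns the latter into |B| minus [nsol B Z h]. *)
Lemma nsol_coset_count h : h \in A ->
  nsol S S (h * beta) = (#|X| + nsol B Z h)%N.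
Proof.
move=> Ah; rewrite nsol_conn_coset // (nsolC cAA (U := X)) //.
have := nsol_partition sYA Ah; rewrite card_coset_part.
rewrite (nsolC cAA (U := Y) (V := B)) ?base_sub //.
have := nsolDr B h twin_sub; rewrite -/Y (nsolT base_sub) //.
by clear; lia.
Qed.

(** For either [Z], the sets [Y] and [f @: Y] are the complements of [X] and [f @: X] in some order;
    inclusion-exclusion yields the constant |A| - 2|X| = |B|. *)
Lemma nsol_group_count g : g \in A ->
  nsol S S g = (#|B| + nsol X X g + nsol X (f @: X) (g * beta ^- 2))%N.
Proof.
move=> Ag; rewrite nsol_conn_group //; set g' := g * _.
have Ag' : g' \in A by rewrite groupM ?groupV.
pose V : {set gT} := A :\: X; pose W : {set gT} := A :\: f @: X.
have sVA : V \subset A := subsetDl _ _; have sWA : W \subset A := subsetDl _ _.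
have -> : nsol Y (f @: Y) g' = nsol V W g'.
  rewrite twist_setD ?twin_sub // /Y /V /W; case: defZ => -> //.
  by rewrite twist_setK // (nsolC cAA) ?subsetDl.
have cV : (#|X| + #|V|)%N = #|A| by rewrite -(cardsID X A) (setIidPr sXA).
have eV : (nsol V (f @: X) g' + nsol V W g')%N = #|V| by rewrite nsolDr // nsolT.
have efX : (nsol (f @: X) X g' + nsol (f @: X) V g')%N = #|X|.
  by rewrite nsolDr // nsolT // card_twist.
move: eV efX; rewrite (nsolC cAA (U := V) (V := f @: X)) //.
rewrite (nsolC cAA (U := f @: X) (V := X)) //; have := card_partition_twist.
by clear - cV; lia.
Qed.

Lemma coset_neq1 h : h \in A -> h * beta != 1.
Proof. by move=> /coset_notin; apply: contraNneq => ->. Qed.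

(** The value mu sits on [Z] because [h * beta] is in [S] exactly when [h] is not in [Z]. Since [f]
    fixes [B] setwise, applying it carries the statement for [Z] to [f @: Z], so both [X] and
    [f @: X] are reached. *)
Lemma dsrg_nsol_base N k mu lam t h :
  is_dsrg (cayley_rel S) N k mu lam t -> h \in A ->
  (#|X| + nsol B X h)%N = (if h \in X then mu else lam) /\
  (#|X| + nsol B (f @: X) h)%N = (if h \in f @: X then mu else lam).
Proof.
move=> /is_dsrg_cayleyP[_ _ _ _ [_ hS]].
have hZ g : g \in A -> (#|X| + nsol B Z g)%N = if g \in Z then mu else lam.
  move=> Ag; rewrite -nsol_coset_count // hS ?coset_neq1 // conn_coset //.
  by rewrite !inE Ag andbT; case: (g \in Z).
have hfZ g : g \in A -> (#|X| + nsol B (f @: Z) g)%N = if g \in f @: Z then mu else lam.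
  move=> Ag; rewrite mem_twist ?twin_sub // -hZ ?fA //.
  rewrite -[in LHS](twistK Ag) -[B in LHS]twist_base (nsol_im twist_inj fA twist_divr) //;
    by rewrite ?base_sub ?twin_sub ?fA.
move=> Ah; have := hZ h Ah; have := hfZ h Ah.
by case: defZ => ->; rewrite ?twist_setK.
Qed.

(** An empty [X] would give t = |B| = k, against t < k. *)
Lemma dsrg_neq0 N k mu lam t : is_dsrg (cayley_rel S) N k mu lam t -> X != set0.
Proof.
move=> /is_dsrg_cayleyP[_ /andP[_ ltk] _ hk [ht _]]; apply/eqP=> X0.
have := card_conn sXA sYA; rewrite -/S hk card_coset_part => ek.
move: ht; rewrite nsol_group_count // /nsol X0 imset0 !big_set0.
by move: ek; rewrite X0 cards0; clear - ltk; lia.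
Qed.

Lemma dsrg_base N k mu lam t : is_dsrg (cayley_rel S) N k mu lam t ->
  group_set B /\ {in X & B, forall x b, x * b \in X}.
Proof.
move=> hS; have hn := card_partition_twist.
(* By the partition, [nsol B B h] is |B| minus the counts for [X] and [f @: X]. Off [B], exactly one
   of these two sets contains [h], so one count involves mu and the other lambda. *)
have hBB : {in A, forall h, nsol B B h = if h \in B then #|A| - 2 * lam
                                         else #|A| - (lam + mu)}%N.
  move=> h Ah; have [h1 h2] := dsrg_nsol_base hS Ah.
  have hU := nsol_partition base_sub Ah.
  have -> : (h \in B) = ~~ ((h \in X) || (h \in f @: X)) by rewrite defB !inE Ah andbT.
  have := disjointFr dXf (x := h).
  move: hn h1 h2 hU; move: #|A| #|X| #|B| (h \in X) (h \in f @: X) => a m l; clear.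
  by case=> [|] [|] /=; [move=> _ _ _ _ /(_ isT)| | |]; lia.
have [gB hP] := nsol_two_valued_group cAA base_sub base1 hBB.
split=> // x b Xx Bb; have Ax := subsetP sXA x Xx; have Ab := subsetP base_sub b Bb.
apply/negPn/negP => nXxb; have [h1 _] := dsrg_nsol_base hS (groupM Ax Ab).
have B0 : (0 < #|B|)%N by apply/card_gt0P; exists 1; apply: base1.
(* From |A| - 2 lambda = |B| > 0, where positivity rules out a truncated subtraction. With lambda =
   |X|, an element outside [X] has no factorization in [B] times [X], yet [x * b] has one. *)
have lamE : lam = #|X| by clear - hn hP B0; lia.
move: h1; rewrite ifN // lamE -[RHS]addn0 => /addnI/nsol_eq0/(_ x Xx).
by rewrite (centsP cAA x Ax b Ab) mulgK Bb.
Qed.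

Lemma base_dsrg n : #|A| = n -> group_set B -> X != set0 ->
  {in X & B, forall x b, x * b \in X} -> f (beta ^+ 2) = beta ^+ 2 ->
  is_dsrg (cayley_rel S) (2 * n) n
    ((n + #|B|) %/ 2) ((n - #|B|) %/ 2) ((n + #|B|) %/ 2).
Proof.
move=> cardA gB nX0 XB falpha; have hn := card_partition_twist.
have hm : (0 < #|X|)%N by rewrite card_gt0.
pose H := Group gB; have BA := subsetP base_sub.
(* Both halvings are exact because n = 2|X| + |B|. *)
have -> : ((n + #|B|) %/ 2 = #|X| + #|B|)%N by clear - hn cardA; lia.
have -> : ((n - #|B|) %/ 2 = #|X|)%N by clear - hn cardA; lia.
have XBE (b x : gT) : b \in B -> (x * b \in X) = (x \in X).
  move=> Bb; apply/idP/idP => [Xxb|Xx]; last exact: XB.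
  by rewrite -(mulgK b x) XB // (groupVr (G := H)).
have fXB (x b : gT) : x \in A -> b \in B -> (x * b \in f @: X) = (x \in f @: X).
  move=> Ax Bb; have Ab := BA b Bb; rewrite !mem_twist ?groupM //.
  have Bfb : f b \in B by rewrite -mem_twist ?base_sub // twist_base.
  have B1 : (f b)^-1 \in B by rewrite (groupVr (G := H)).
  by rewrite -(XBE _ (f (x * b)) B1) -twist_divr ?groupM // mulgK.
have ZB (x b : gT) : x \in A -> b \in B -> (x * b \in Z) = (x \in Z).
  by case: defZ => -> Ax Bb; [apply: XBE|apply: fXB].
have nsolZ h : h \in A -> nsol B Z h = (if h \in Z then #|B| else 0)%N.
  move=> Ah; rewrite (nsolC cAA) ?base_sub ?twin_sub //.
  by apply: nsol_stable => b Bb; rewrite ZB // (groupVr (G := H)).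
(* A fixed point of [f] lies in [X] iff it lies in [f @: X], and these are disjoint. *)
have Balpha : beta ^+ 2 \in B.
  rewrite defB !inE Abeta2 andbT mem_twist // falpha orbb.
  apply/negP => Xa; have := disjointFr dXf Xa.
  by rewrite mem_twist // falpha Xa.
(* The shift by [beta ^- 2], an element of [B], does not affect membership in [X]. The two remaining
   counts then add up to |X| - [nsol X B g], and [nsol X B g] is |B| on [X] and 0 off it. *)
have hA g : g \in A -> nsol S S g = (if g \in X then #|X| else #|X| + #|B|)%N.
  move=> Ag; rewrite nsol_group_count //.
  have -> : nsol X (f @: X) (g * beta ^- 2) = nsol X (f @: X) g.
    apply: eq_bigr => x /(subsetP sfXA) Ax.
    rewrite -mulgA (centsP cAA (beta ^- 2)) ?groupV // mulgA (XBE (beta ^- 2)) //.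
    by rewrite (groupVr (G := H)).
  have := nsol_partition sXA Ag.
  have -> : nsol X B g = (if g \in X then #|B| else 0)%N.
    by apply: nsol_stable => b Bb; rewrite XBE // (groupVr (G := H)).
  by case: (g \in X); lia.
apply/is_dsrg_cayleyP; split.
- rewrite -cardsT -covA.
  have -> : #|A :|: A :* beta| = (#|A| + #|A|)%N by apply: card_conn.
  by lia.
(* Here t = |X| + |B| < 2|X| + |B| = k because [X] is nonempty. *)
- by lia.
- by rewrite conn_group.
- by rewrite card_conn // card_coset_part; lia.
split=> [|g ng1]; first by rewrite hA // (negPf nX1).
have : g \in A :|: A :* beta by rewrite covA inE.
case/setUP => [Ag|/rcosetP[h Ah ->]]; first by rewrite hA // conn_group.
rewrite nsol_coset_count // conn_coset // inE Ah andbT nsolZ //.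
by case: (h \in Z) => /=; rewrite ?addn0.
Qed.

End IndexTwo.

(** * Unions of cosets, and the theorem *)

Lemma union_of_cosets_stable (gT : finGroupType) (A B : {group gT}) (X : {set gT}) :
  X \subset A ->
  union_of_cosets A B X <-> X != set0 /\ {in B & X, forall b x, b * x \in X}.
Proof.
move=> sXA; split=> [[P [nP0 sPA ->]]|[nX0 BX]].
  split=> [|b x Bb /bigcupP[C PC Cx]].
    have /set0Pn[C PC] := nP0; have /rcosetsP[a Aa defC] := subsetP sPA C PC.
    by apply/set0Pn; exists a; apply/bigcupP; exists C => //; rewrite defC rcoset_refl.
  apply/bigcupP; exists C => //; have /rcosetsP[a Aa defC] := subsetP sPA C PC.
  by move: Cx; rewrite defC !mem_rcoset -mulgA => Cx; apply: groupM.
(* The family of all cosets of [B] that have a representative in [X]. *)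
exists (rcosets B X); split.
- have /set0Pn[x Xx] := nX0; apply/set0Pn; exists (B :* x).
  by apply/rcosetsP; exists x.
- apply/subsetP=> _ /rcosetsP[x Xx ->]; apply/rcosetsP; exists x => //.
  exact: (subsetP sXA).
apply/setP=> x; apply/idP/bigcupP => [Xx|[_ /rcosetsP[y Xy ->]]].
  by exists (B :* x); rewrite ?rcoset_refl //; apply/rcosetsP; exists x.
by case/rcosetP=> b Bb ->; apply: BX.
Qed.

Theorem theorem4 (gT : finGroupType) (n : nat) (A : {group gT})
    (alpha beta : gT) (f : {perm gT}) (X Y B : {set gT})
    (hn : (1 < n)%N)
    (hG : #|[set: gT]| = (2 * n)%N)
    (hnonab : ~~ abelian [set: gT])
    (hA : abelian A)
    (hindex : #|[set: gT] : A| = 2%N)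
    (halpha : alpha \in A)
    (hf : f \in Aut A)
    (hford : #[f] = 2%N)
    (hfalpha : f alpha = alpha)
    (hgen : <<beta |: A>> = [set: gT])
    (hbeta : beta ^+ 2 = alpha)
    (hconj : forall a : gT, a \in A -> beta * a * beta^-1 = f a)
    (hX : X \subset A :\ 1)
    (hXf : X :&: f @: X = set0)
    (hY : Y = A :\: X \/ Y = A :\: f @: X)
    (hB : B = A :\: (X :|: f @: X)) :
  (dsrg (cayley_rel (X :|: Y :* beta)) <->
     group_set B /\ union_of_cosets A B X) /\
  (dsrg (cayley_rel (X :|: Y :* beta)) ->
     is_dsrg (cayley_rel (X :|: Y :* beta)) (2 * n) n
       ((n + #|B|) %/ 2) ((n - #|B|) %/ 2) ((n + #|B|) %/ 2)).
Proof.
have cardA : #|A| = n by have := Lagrange (subsetT A); rewrite hindex hG; lia.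
have fA : {in A, forall a, f a \in A}.
  by move=> a Aa; rewrite (Aut_closed hf).
have fE : {in A, forall a, f a = beta * a * beta^-1} by move=> a /hconj.
have nAbeta : beta \notin A.
  apply/negP=> Abeta; move: hindex; rewrite -hgen.
  have /setUidPr -> : [set beta] \subset A by rewrite sub1set.
  by rewrite genGid indexgg.
have Abeta2 : beta ^+ 2 \in A by rewrite hbeta.
have covA : A :|: A :* beta = [set: gT].
  (* [card_conn] with both parts equal to [A] shows that the two cosets have 2n elements in all. *)
  by apply/eqP; rewrite eqEcard subsetT hG /= (card_conn nAbeta) // cardA mul2n addnn.
move: hX; rewrite subsetD1 => /andP[sXA nX1].
have dXf : [disjoint X & f @: X] by rewrite -setI_eq0 hXf.
have [Z defZ defY] : exists2 Z, Z = X \/ Z = f @: X & Y = A :\: Z.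
  by case: hY => ->; [exists X; [left|]|exists (f @: X); [right|]].
have sBA : B \subset A by rewrite hB subsetDl.
have commX : {in B & X, forall b x, b * x = x * b}.
  by move=> b x /(subsetP sBA) Ab /(subsetP sXA); apply: (centsP hA).
have fwd : dsrg (cayley_rel (X :|: Y :* beta)) -> group_set B /\ union_of_cosets A B X.
  move=> [N [k [mu [lam [t]]]]]; rewrite defY => hS.
  have nX0 := dsrg_neq0 hA fA fE nAbeta Abeta2 sXA dXf defZ hB hS.
  have [gB XB] := dsrg_base hA fA fE nAbeta Abeta2 sXA nX1 dXf defZ hB hS.
  split=> //; apply/(@union_of_cosets_stable _ A (Group gB)) => //; split=> // b x Bb Xx.
  by rewrite commX // XB.
have bwd : group_set B /\ union_of_cosets A B X ->
    is_dsrg (cayley_rel (X :|: Y :* beta)) (2 * n) n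
       ((n + #|B|) %/ 2) ((n - #|B|) %/ 2) ((n + #|B|) %/ 2).
  case=> gB /(@union_of_cosets_stable _ A (Group gB) X sXA)[nX0 BX].
  rewrite defY; apply: (base_dsrg hA fA fE) => //; last by rewrite hbeta.
  by move=> x b Xx Bb; rewrite -commX ?BX.
split; last by move/fwd/bwd.
by split=> [|/bwd hS]; [apply: fwd | do 5 eexists; apply: hS].
Qed.
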